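(* Let $G$ be a digraph rooted at $v$ and let $u$ be an arbitrary vertex of $G$. Put $D=\mathsf{dom}_G(u)$. Then $$\kappa(G)=\kappa\big(\mathsf{root}_u(G[D])\big)\cdot\kappa\big(G(D\to u)\big).$$
   Context: Digraphs are finite directed graphs without loops; parallel edges are allowed. An arborescence of a digraph $G=(V,E)$ is a subdigraph $A$ spanning all of $V$ with a root vertex from which every vertex is reachable along a unique directed path in $A$ (a rooted directed spanning tree with edges directed away from the root). Arborescences are identified with their edge sets. Let $\mathsf{arb}(G)$ be the set of all arborescences of $G$ (over all roots). Each edge carries a label, which is a polynomial variable; distinct edges of the original digraph $G$ have distinct labels (the edge $e$ itself is used as the variable), and edges of digraphs derived from $G$ keep the label of the edge of $G$ they come from. The Kirchhoff polynomial of a digraph is $\kappa(G)=\sum_{A\in\mathsf{arb}(G)}\prod_{e\in A}e$, where $e$ stands for its label; for a one-vertex digraph $\kappa(G)=1$. $G$ is rooted at $v$ if $v$ has no incoming edges and every other vertex is reachable from $v$ by a directed path. If $G$ is rooted at $v$, a vertex $u$ dominates a vertex $w$ if all directed paths from $v$ to $w$ go through $u$; $\mathsf{dom}_G(u)$ denotes the set of all vertices dominated by $u$ (so $u\in\mathsf{dom}_G(u)$). $G[D]$ is the subdigraph induced by $D\subseteq V$. For a digraph $F$ and $u\in V(F)$, $\mathsf{root}_u(F)$ is the digraph obtained from $F$ by removing all edges incoming to $u$. For $S\subseteq V$ and $u\in S$, the contracted digraph $G(S\to u)$ is obtained from $G$ by: (1) removing all edges $xy$ with $x\in V\setminus S$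 and $y\in S\setminus\{u\}$; (2) removing all edges $xy$ with $x,y\in S$; (3) contracting all vertices of $S$ into the single vertex $u$ (so each edge $sz$ with $s\in S$, $z\notin S$ becomes an edge $uz$ with the same label, possibly creating parallel edges, and edges $zu$ with $z\notin S$ are kept). *)

(* Defs.v *)
From HB Require Import structures.
From mathcomp Require Import all_boot all_order all_algebra.
From mathcomp Require Import boolp.
From mathcomp Require Import mpoly.

Set Implicit Arguments.
Unset Strict Implicit.
Unset Printing Implicit Defensive.

Import GRing.Theory.
Local Open Scope ring_scope.

(* The vertices and edges of a digraph are taken inside ambient finite types V
   and E.  The digraphs derived from G live over the same V and E, so that an
   edge of a derived digraph is literally the edge of G it comes from, even when
   its source or target has changed, and hence keeps its label.
   Elements of E outside [eset] carry no information. *)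
Record digraph (V E : finType) := Digraph {
  vset : {set V};
  eset : {set E};
  src : E -> V;
  tgt : E -> V;
  src_vset : forall e, e \in eset -> src e \in vset;
  tgt_vset : forall e, e \in eset -> tgt e \in vset;
  loopless : forall e, e \in eset -> src e != tgt e
}.

Section Digraphs.
Variables V E : finType.
Implicit Types (G : digraph V E) (S D : {set V}) (A : {set E}).

(* Directed paths are sequences of edges, so that paths through distinct
   parallel edges are distinct.  Vertices may be repeated: unicity of the path
   from the root then excludes every cycle from an arborescence. *)
Fixpoint dipath G (x : V) (p : seq E) (y : V) : bool :=
  if p is e :: p' then [&& e \in eset G, src G e == x & dipath G (tgt G e) p' y]
  else (x \in vset G) && (x == y).

Definition visits G (x : V) (p : seq E) (u : V) : bool :=
  u \in x :: map (tgt G) p.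

Definition rooted G (v : V) : Prop :=
  [/\ v \in vset G,
      forall e, e \in eset G -> tgt G e != v &
      forall w, w \in vset G -> w != v -> exists p, dipath G v p w].

Definition dominates G (v u w : V) : Prop :=
  forall p, dipath G v p w -> visits G v p u.

Definition dom G (v u : V) : {set V} :=
  [set w in vset G | `[< dominates G v u w >]].

Lemma dom_refl G (v u : V) : u \in vset G -> u \in dom G v u.
Proof.
move=> uG; rewrite inE uG; apply/asboolP => p.
elim: p v => [|e p IHp] v /=; first by move=> /andP[_ /eqP->]; exact: mem_head.
by move=> /and3P[_ _ /IHp]; rewrite /visits => up; rewrite inE up orbT.
Qed.

Section Subdigraphs.
Variable G : digraph V E.

Section Restrict.
Variable A : {set E}.
Definition restrict_eset := eset G :&: A.
Lemma restrict_sub e : e \in restrict_eset -> e \in eset G.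
Proof. by case/setIP. Qed.

Definition restrict_edges : digraph V E :=
  Digraph (fun e eA => src_vset (restrict_sub eA))
          (fun e eA => tgt_vset (restrict_sub eA))
          (fun e eA => loopless (restrict_sub eA)).
End Restrict.

Definition root_at (u : V) : digraph V E :=
  restrict_edges [set e | tgt G e != u].

Section Induced.
Variable D : {set V}.
Definition induced_vset := vset G :&: D.
Definition induced_eset :=
  [set e in eset G | (src G e \in D) && (tgt G e \in D)].

Lemma induced_src e : e \in induced_eset -> src G e \in induced_vset.
Proof. by rewrite !inE => /and3P[/src_vset-> ->]. Qed.

Lemma induced_tgt e : e \in induced_eset -> tgt G e \in induced_vset.
Proof. by rewrite !inE => /and3P[/tgt_vset-> _ ->]. Qed.

Lemma induced_loopless e : e \in induced_eset -> src G e != tgt G e.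
Proof. by rewrite inE => /andP[/loopless]. Qed.

Definition induced : digraph V E :=
  Digraph induced_src induced_tgt induced_loopless.
End Induced.

Section Contract.
Variables (S : {set V}) (u : V) (uS : u \in S).
Definition contract_vertex (x : V) : V := if x \in S then u else x.
Definition contract_vset := u |: (vset G :\: S).
Definition contract_eset := [set e in eset G |
  ~~ ((src G e \notin S) && (tgt G e \in S :\ u)) &&
  ~~ ((src G e \in S) && (tgt G e \in S))].

Lemma image_vset x : x \in vset G -> contract_vertex x \in contract_vset.
Proof.
move=> xG; rewrite /contract_vertex; case: ifPn => xS; rewrite !inE ?eqxx //.
by rewrite xS xG orbT.
Qed.

Lemma contract_src e :
  e \in contract_eset -> contract_vertex (src G e) \in contract_vset.
Proof. by rewrite inE => /andP[/src_vset /image_vset]. Qed.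

Lemma contract_tgt e :
  e \in contract_eset -> contract_vertex (tgt G e) \in contract_vset.
Proof. by rewrite inE => /andP[/tgt_vset /image_vset]. Qed.

Lemma contract_loopless e :
  e \in contract_eset -> contract_vertex (src G e) != contract_vertex (tgt G e).
Proof.
rewrite inE => /and3P[eG _]; rewrite /contract_vertex.
case: ifPn => sS; case: ifPn => tS //= _; last exact: loopless.
- by apply: contraNneq tS => <-.
- by apply: contraNneq sS => ->.
Qed.

Definition contract : digraph V E :=
  Digraph contract_src contract_tgt contract_loopless.
End Contract.

End Subdigraphs.

Definition arborescence G A : Prop :=
  A \subset eset G /\
  exists2 r, r \in vset G &
    forall w, w \in vset G -> exists! p, dipath (restrict_edges G A) r p w.

Definition kirchhoff G : {mpoly int[#|E|]} :=
  \sum_(A : {set E} | `[< arborescence G A >]) \prod_(e in A) 'X_(enum_rank e).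

End Digraphs.

Arguments contract {V E} G S u uS.

(* Main.v *)
(** Write [D] for the set of vertices dominated by [u].  An edge entering [D]
    from outside must end in [u]: its source is reachable avoiding [u].  An edge
    from [D] to [u] lies in no arborescence of [G], since it would close a cycle
    with the path of the arborescence from [v] to its source, which visits [u].
    So an arborescence [A] of [G] splits into its edges inside [D], which form an
    arborescence of [G[D]] rooted at [u], and the others, which form an
    arborescence of the contraction rooted at [v]; conversely, any two such
    arborescences glue together.  The identity sums this bijection. *)

Require Import Defs.
From mathcomp Require Import all_boot all_order all_algebra.
From mathcomp Require Import boolp.
From mathcomp Require Import mpoly.

Local Open Scope ring_scope.

(** * Directed paths, and arborescences whose root is forced *)

Section Paths.
Context {V E : finType}.
Implicit Types (G H : digraph V E) (x y u r w : V) (p q : seq E) (A : {set E}).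

Lemma dipath_nil G x : x \in vset G -> dipath G x [::] x.
Proof. by move=> /= ->; rewrite eqxx. Qed.

Lemma dipath_src G x p y : dipath G x p y -> x \in vset G.
Proof. by case: p => [|e p] /= => [/andP[]//|/and3P[/src_vset ? /eqP<-]]. Qed.

Lemma dipath_rcons G x p e y :
  dipath G x (rcons p e) y =
  [&& dipath G x p (src G e), e \in eset G & tgt G e == y].
Proof.
elim: p x => [|f p IHp] x /=; last by rewrite IHp !andbA.
case eG: (e \in eset G); rewrite ?andbF //= (tgt_vset eG) eq_sym.
by case: eqP => [->|]; rewrite ?andbF //= (src_vset eG).
Qed.

Lemma dipath_cat G x p y q z :
  dipath G x p y -> dipath G y q z -> dipath G x (p ++ q) z.
Proof.
elim: p x => [|e p IHp] x /= => [/andP[_ /eqP->]//|].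
by move=> /and3P[-> -> /IHp yz] /yz.
Qed.

Lemma dipath_sub G H x p y :
    src G =1 src H -> tgt G =1 tgt H ->
    vset G \subset vset H -> eset G \subset eset H ->
  dipath G x p y -> dipath H x p y.
Proof.
move=> eqs eqt /subsetP sV /subsetP sE.
elim: p x => [|e p IHp] x /= => [/andP[/sV-> ->]//|].
by move=> /and3P[/sE-> /eqP<- /IHp]; rewrite eqs eqxx eqt.
Qed.

Lemma dipath_restrict G A x p y : dipath (restrict_edges G A) x p y -> dipath G x p y.
Proof. by apply: dipath_sub => //; apply: subsetIl. Qed.

Lemma eset_restrict G A : eset (restrict_edges G A) = eset G :&: A.
Proof. by []. Qed.

Lemma visits_prefix G x p y u : dipath G x p y -> visits G x p u ->
  exists p1 p2, p = p1 ++ p2 /\ dipath G x p1 u.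
Proof.
rewrite /visits; elim: p x => [|e p IHp] x.
  by move=> /dipath_src xG; rewrite inE => /eqP->; exists [::], [::]; rewrite /= xG eqxx.
move=> xy; rewrite inE => /predU1P[->|].
  by exists [::], (e :: p); rewrite /= (dipath_src _ _ _ _ xy) eqxx.
move: xy => /= /and3P[eG sx /IHp ey] /ey[p1 [p2 [-> uP]]].
by exists (e :: p1), p2; rewrite /= eG sx uP.
Qed.

(** Both paths are read backwards from [w]: the current vertex determines the edge entering it, and
    since no edge enters [r] the two readings stop together. *)
Lemma dipath_uniq G r p q w :
    (forall e, e \in eset G -> tgt G e != r) -> {in eset G &, injective (tgt G)} ->
  dipath G r p w -> dipath G r q w -> p = q.
Proof.
move=> nr injt; elim/last_ind: p q w => [|p e IHp] q w; case/lastP: q => [|q f] //.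
- move=> /= /andP[_ /eqP<-]; rewrite dipath_rcons => /and3P[_ /nr].
  by move=> /negbTE->.
- rewrite dipath_rcons => /and3P[_ /nr te /eqP ew] /= /andP[_ /eqP rw].
  by rewrite ew rw eqxx in te.
rewrite !dipath_rcons => /and3P[pe eG /eqP ew] /and3P[qf fG /eqP fw].
have ef : e = f by apply: injt; rewrite // ew.
by rewrite -ef in qf *; rewrite (IHp _ _ pe qf).
Qed.

(** Trades uniqueness of paths for a local condition on targets, which is easy to restrict and to
    glue. Two edges of [A] with a common target would give two paths to that target. *)
Lemma arborescence_rootP G r A :
    r \in vset G -> (forall e, e \in eset G -> tgt G e != r) ->
  arborescence G A <->
  [/\ A \subset eset G, {in A &, injective (tgt G)} &
      forall w, w \in vset G -> exists p, dipath (restrict_edges G A) r p w].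
Proof.
move=> rG nr; split=> [[AG [r' r'G arb]]|[AG injt arb]].
  (* The root [r'] is [r]: a nonempty path from [r'] to [r] would end with an edge entering [r]. *)
  have {r' r'G arb}arb w : w \in vset G ->
      exists! p, dipath (restrict_edges G A) r p w.
    have [p [rp _]] := arb r rG; case/lastP: p rp => [/andP[_ /eqP<-]|p e].
      exact: arb.
    by rewrite dipath_rcons => /and3P[_ /setIP[/nr/negbTE/= ->]].
  split=> // [e f eA fA eqt|w /arb[p [rp _]]]; last by exists p.
  have AH a : a \in A -> a \in eset (restrict_edges G A).
    by move=> aA; rewrite inE aA (subsetP AG).
  have [p [rp _]] := arb _ (src_vset (AH _ eA)).
  have [q [rq _]] := arb _ (src_vset (AH _ fA)).
  have [s [_ us]] := arb _ (tgt_vset (AH _ eA)).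
  have pe : s = rcons p e by apply: us; rewrite dipath_rcons rp AH //= eqxx.
  have qf : s = rcons q f by apply: us; rewrite dipath_rcons rq AH //= eqt eqxx.
  by have := rcons_inj (etrans (esym pe) qf); case.
split=> //; exists r => // w /arb[p rp]; exists p; split=> // q rq.
apply: dipath_uniq rp rq => [e /setIP[/nr]//|e f /setIP[_ eA] /setIP[_ fA]].
exact: injt.
Qed.

End Paths.

(** * Splitting and gluing arborescences along a dominated set *)

Section Domination.
Context {V E : finType}.
Variables (G : digraph V E) (v u : V).
Hypotheses (Gv : rooted G v) (uG : u \in vset G).

Local Notation D := (dom G v u).
Local Notation I := (root_at (induced G D) u).
Local Notation C := (contract G D u (dom_refl v uG)).

Lemma vset_root : v \in vset G. Proof. by case: Gv. Qed.

Lemma root_not_tgt e : e \in eset G -> tgt G e != v. Proof. by case: Gv => _ + _; apply. Qed.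

Lemma root_in_dom : v \in D -> v = u.
Proof.
rewrite inE => /andP[_ /asboolP/(_ [::])]; rewrite /= vset_root eqxx => /(_ isT).
by rewrite /visits inE => /eqP.
Qed.

Lemma contract_root : contract_vertex D u v = v.
Proof. by rewrite /contract_vertex; case: ifPn => // /root_in_dom. Qed.

Lemma contract_notin x : x \notin D -> contract_vertex D u x = x.
Proof. by rewrite /contract_vertex => /negbTE->. Qed.

Lemma contract_in x : x \in D -> contract_vertex D u x = u.
Proof. by rewrite /contract_vertex => ->. Qed.

(** A path from [v] to the source of [e] extends along [e] to a path that visits [u]; as [e] does
    not end in [u], the visit occurs before [e]. *)
Lemma edge_into_dom e :
  e \in eset G -> tgt G e \in D -> tgt G e != u -> src G e \in D.
Proof.
move=> eG tD tu; rewrite inE (src_vset eG); apply/asboolP => p vp.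
move: tD; rewrite inE => /andP[_ /asboolP/(_ (rcons p e))].
rewrite dipath_rcons vp eG eqxx => /(_ isT).
by rewrite /visits map_rcons -rcons_cons mem_rcons inE eq_sym (negbTE tu).
Qed.

Lemma eset_inducedE e : (e \in eset I) =
  [&& e \in eset G, src G e \in D, tgt G e \in D & tgt G e != u].
Proof. by rewrite 3!inE -!andbA. Qed.

Lemma eset_contractE e : (e \in eset C) =
  [&& e \in eset G, (tgt G e \notin D) || (tgt G e == u)
    & (tgt G e \in D) ==> (src G e \notin D)].
Proof.
rewrite [LHS]inE in_setD1; case eG: (e \in eset G) => //=.
have := edge_into_dom e eG.
by case: (tgt G e \in D); case: (src G e \in D); case: eqP => //= _ /(_ isT isT).
Qed.

(** Contraction moves only sources of the surviving edges, so conditions on targets pass unchanged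
    between [G] and [C]. *)
Lemma tgt_contract e : e \in eset C -> tgt C e = tgt G e.
Proof.
rewrite eset_contractE => /and3P[_ tDu _] /=.
by case/orP: tDu => [/contract_notin//|/eqP->]; rewrite contract_in ?dom_refl.
Qed.

Lemma induced_root : u \in vset I. Proof. by rewrite inE uG dom_refl. Qed.

Lemma induced_root_not_tgt e : e \in eset I -> tgt I e != u.
Proof. by rewrite eset_inducedE => /and4P[]. Qed.

Lemma vset_contract_root : v \in vset C.
Proof. by rewrite -[in X in X \in _]contract_root; apply: image_vset; exact: vset_root. Qed.

Lemma contract_root_not_tgt e : e \in eset C -> tgt C e != v.
Proof.
move=> eC; rewrite tgt_contract //; apply: root_not_tgt.
by move: eC; rewrite eset_contractE => /andP[].
Qed.

Lemma disjoint_induced_contract : [disjoint eset I & eset C].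
Proof.
rewrite disjoint_subset; apply/subsetP => e.
rewrite eset_inducedE => /and4P[_ sD tD tu]; rewrite inE.
by rewrite eset_contractE tD sD /= !andbF.
Qed.

(** The edges of [G] missing from both derived digraphs are those from [D] to [u], so only these
    have to be excluded. *)
Lemma arborescence_split A : arborescence G A -> A \subset eset I :|: eset C.
Proof.
move=> /(arborescence_rootP G v A vset_root root_not_tgt)[AG injt arb].
apply/subsetP => e eA; have eG := subsetP AG _ eA.
rewrite inE eset_inducedE eset_contractE eG /=.
have := edge_into_dom e eG.
case: (boolP (tgt G e \in D)) => tD; last by rewrite orbT.
case: eqP => /= [tu _|_ /(_ isT isT)->//].
rewrite andbF; apply/negP => sD.
have [p vp] := arb _ (src_vset eG).
have up : visits (restrict_edges G A) v p u.
  by move: sD; rewrite inE => /andP[_ /asboolP]; apply; apply: dipath_restrict vp.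
have [p1 [p2 [def_p vp1]]] := visits_prefix _ _ _ _ _ vp up.
have vpe : dipath (restrict_edges G A) v (rcons p e) u.
  by rewrite dipath_rcons vp inE eG eA tu eqxx.
(* Both paths lead from [v] to [u] in [A], hence coincide; but [p1] is a prefix of [p], thus shorter
   than [rcons p e]. *)
have /(congr1 size) : p1 = rcons p e.
  apply: dipath_uniq vp1 vpe => [f /setIP[/root_not_tgt]//|f g].
  by move=> /setIP[_ fA] /setIP[_ gA]; apply: injt.
by move/eqP; rewrite def_p size_rcons size_cat eqn_leq ltnNge leq_addr andbF.
Qed.

(** Read backwards, the path of [A] from [v] to a vertex of [D] stays in [D] until it meets [u]; the
    edges after that point form the required path. *)
Lemma arborescence_induced A : arborescence G A -> arborescence I (A :&: eset I).
Proof.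
move=> /(arborescence_rootP G v A vset_root root_not_tgt)[AG injt arb].
apply/(arborescence_rootP _ _ _ induced_root induced_root_not_tgt).
split=> [|e f /setIP[eA _] /setIP[fA _]|w]; [exact: subsetIr | exact: injt |].
rewrite inE => /andP[wG wD]; have [p] := arb _ wG.
elim/last_ind: p w wD {wG} => [|p e IHp] w wD.
  move=> /= /andP[_ /eqP vw]; exists [::].
  rewrite -vw in wD *; rewrite [X in dipath _ _ _ X](root_in_dom wD).
  by apply: dipath_nil; exact: induced_root.
rewrite dipath_rcons => /and3P[vp /setIP[eG eA] /eqP /= tw].
have [->|wu] := eqVneq w u.
  by exists [::]; apply: dipath_nil; exact: induced_root.
have sD : src G e \in D by apply: edge_into_dom; rewrite ?tw.
have [q uq] := IHp _ sD vp; exists (rcons q e).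
have eI : e \in eset I by rewrite eset_inducedE eG sD tw wD wu.
by rewrite dipath_rcons uq eset_restrict in_setI [e \in _ :&: _]in_setI eA eI /= tw eqxx.
Qed.

(** Paths of [A] project to the contraction: edges of [I] collapse to the vertex [u], and the others
    survive. *)
Lemma arborescence_contract A : arborescence G A -> arborescence C (A :&: eset C).
Proof.
move=> arbA; have AIC := arborescence_split _ arbA.
move: arbA => /(arborescence_rootP G v A vset_root root_not_tgt)[AG injt arb].
apply/(arborescence_rootP _ _ _ vset_contract_root contract_root_not_tgt).
split=> [|e f /setIP[eA eC] /setIP[fA fC]|w wC]; first exact: subsetIr.
  by rewrite !tgt_contract //; apply: injt.
(* Writing [w] as its own image lets the induction run over all vertices of [G], including those in
   [D] met on the way. *)
have [wG <-] : w \in vset G /\ contract_vertex D u w = w.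
  move: wC => /setU1P[->|/setDP[wG /contract_notin//]].
  by rewrite contract_in ?dom_refl.
have [p] := arb _ wG.
elim/last_ind: p w {wG wC} => [|p e IHp] w.
  move=> /= /andP[_ /eqP<-]; exists [::].
  by rewrite contract_root /= eqxx andbT vset_contract_root.
rewrite dipath_rcons => /and3P[vp /setIP[eG eA] /eqP /= <-].
have [q vq] := IHp _ vp.
have /setUP[eI|eC] := subsetP AIC _ eA.
  move: eI; rewrite eset_inducedE => /and4P[_ sD tD _].
  have -> : contract_vertex D u (tgt G e) = contract_vertex D u (src G e).
    by rewrite !contract_in.
  by exists q.
by exists (rcons q e); rewrite dipath_rcons vq eset_restrict in_setI [e \in _ :&: _]in_setI eA eC /= eqxx.
Qed.

(** Targets of [B] lie in [D] minus [u], those of [A] outside [D] or at [u], so targets in the union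
    stay distinct. A path in the contraction lifts to [G] by inserting, before each edge leaving
    [D], a path of [B] from [u] to its true source. *)
Lemma arborescence_glue B A :
  arborescence I B -> arborescence C A -> arborescence G (B :|: A).
Proof.
move=> /(arborescence_rootP _ _ _ induced_root induced_root_not_tgt)[sBI injB arbB].
move=> /(arborescence_rootP _ _ _ vset_contract_root contract_root_not_tgt)[sAC injA arbA].
apply/(arborescence_rootP G v _ vset_root root_not_tgt).
have BG e : e \in B -> [/\ e \in eset G, tgt G e \in D & tgt G e != u].
  by move=> /(subsetP sBI); rewrite eset_inducedE => /and4P[].
have AG e : e \in A -> e \in eset G /\ ((tgt G e \notin D) || (tgt G e == u)).
  by move=> /(subsetP sAC); rewrite eset_contractE => /and3P[].
have BAt e f : e \in B -> f \in A -> tgt G e <> tgt G f.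
  move=> /BG[_ eD eu] /AG[_ fDu] tef; move: fDu.
  by rewrite -tef eD (negbTE eu).
have sub : B :|: A \subset eset G.
  by apply/subsetP => e /setUP[/BG|/AG]; case.
have inD w : w \in D -> exists p, dipath (restrict_edges G (B :|: A)) u p w.
  move=> wD; have wI : w \in vset I.
    by rewrite inE wD andbT; move: wD; rewrite inE => /andP[].
  have [p up] := arbB _ wI; exists p; apply: dipath_sub up => //.
    exact: subsetIl.
  apply/subsetP => e /setIP[_ eB].
  by rewrite !inE eB andbT; case: (BG _ eB).
have outD p w : dipath (restrict_edges C A) v p w ->
    exists q, dipath (restrict_edges G (B :|: A)) v q w.
  elim/last_ind: p w => [|p e IHp] w.
    by move=> /= /andP[_ /eqP<-]; exists [::]; rewrite /= eqxx vset_root.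
  rewrite dipath_rcons => /and3P[/IHp[q vq] /setIP[eC eA] /eqP].
  rewrite [tgt _ e](tgt_contract e eC) => <-.
  (* The lifted path [q] ends at the contracted source of [e]; if the true source lies in [D], this
     is [u], and [inD] supplies the missing stretch. *)
  have [q' vq'] : exists q', dipath (restrict_edges G (B :|: A)) v q' (src G e).
    case: (boolP (src G e \in D)) => sD.
      have [s us] := inD _ sD; exists (q ++ s); apply: dipath_cat us.
      by move: vq => /=; rewrite contract_in.
    by exists q; move: vq => /=; rewrite contract_notin.
  exists (rcons q' e); rewrite dipath_rcons vq' !inE eA orbT eqxx.
  by case: (AG _ eA) => ->.
split=> // [e f /setUP[eB|eA] /setUP[fB|fA] tef|w wG].
- exact: injB.
- by case: (BAt e f).
- by case: (BAt f e).
- by apply: injA; rewrite // !tgt_contract ?(subsetP sAC).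
case: (boolP (w \in D)) => wD.
  have uC : u \in vset C by rewrite setU11.
  have [p /outD[q vq]] := arbA _ uC; have [s us] := inD _ wD.
  by exists (q ++ s); apply: dipath_cat us.
have wC : w \in vset C by apply/setUP; right; apply/setDP.
by have [p /outD] := arbA _ wC.
Qed.

End Domination.

Theorem theorem4p2 (V E : finType) (G : digraph V E) (v u : V)
    (Gv : rooted G v) (uG : u \in vset G) :
  let D := dom G v u in
  kirchhoff G =
    kirchhoff (root_at (induced G D) u) * kirchhoff (contract G D u (dom_refl v uG)).
Proof.
move=> D; set I := root_at _ u; set C := contract _ _ _ _.
have dIC : [disjoint eset I & eset C] := disjoint_induced_contract G v u uG.
rewrite /kirchhoff big_distrlr pair_big /=.
(* Union and the pair of intersections are the two directions of the bijection; [arborescence_split]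
   shows that splitting and then uniting returns [A]. *)
rewrite (reindex_onto (fun BA : {set E} * {set E} => BA.1 :|: BA.2)
  (fun A => (A :&: eset I, A :&: eset C))) /=; last first.
  move=> A /asboolP /(arborescence_split G v u Gv uG) sub.
  by rewrite -setIUr; apply/setIidPl.
have cap (B A : {set E}) : B \subset eset I -> A \subset eset C ->
    (B :|: A) :&: eset I = B /\ (B :|: A) :&: eset C = A.
  move=> sBI sAC; rewrite !setIUl (setIidPl sBI) (setIidPl sAC).
  have -> : A :&: eset I = set0.
    by apply/disjoint_setI0; rewrite disjoint_sym; apply: disjointWr sAC dIC.
  have -> : B :&: eset C = set0 by apply/disjoint_setI0; apply: disjointWl sBI dIC.
  by rewrite setU0 set0U.
apply: eq_big => [[B A]|[B A]] /=.
  apply/andP/andP => [[/asboolP arb /eqP[defB defA]]|[/asboolP arbB /asboolP arbA]].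
    have := arborescence_contract G v u Gv uG _ arb.
    have := arborescence_induced G v u Gv uG _ arb.
    by rewrite defB defA => arbB arbA; split; apply/asboolP.
  split; first by apply/asboolP; apply: (arborescence_glue G v u Gv uG) arbB arbA.
  by have [-> ->] := cap _ _ arbB.1 arbA.1.
move=> /andP[_ /eqP[defB defA]].
have sBI : B \subset eset I by rewrite -defB subsetIr.
have sAC : A \subset eset C by rewrite -defA subsetIr.
(* Disjointness of [B] and [A] makes the product of the two monomials the monomial of their
   union. *)
rewrite -bigU ?(disjointW sBI sAC) //=.
by apply: eq_bigl => e; rewrite !inE.
Qed.
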